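(* Let $(G,\tau)$ and $(H,\sigma)$ be topological groups and $f:(G,\tau)\to(H,\sigma)$ a continuous surjective homomorphism. If $f$ is A$^*$-open, then $f$ is A-open.
   Context: Topological groups are not assumed Hausdorff. $\mathcal V_{(G,\tau)}(e_G)$ is the filter of all neighborhoods of $e_G$ in $(G,\tau)$. For a neighborhood $U$ of $e_G$, a subset $M\subseteq G$ is $U$-thin if $\bigcap\{x^{-1}Ux:x\in M\}$ is a neighborhood of $e_G$. Write $[x,y]=xyx^{-1}y^{-1}$ and, for $g\in G$ and $K\subseteq G$, $[g,K]=\{[g,k]:k\in K\}$. A section of a surjective homomorphism $f:G\to H$ is an injective function $s:H\to G$ such that $f(s(h))=h$ for every $h\in H$ and $s(e_H)=e_G$ (no continuity required). A homomorphism $f:(G,\tau)\to(H,\sigma)$ is A-open if for every $U\in\mathcal V_{(G,\tau)}(e_G)$: (a) there exists $V\in\mathcal V_{(H,\sigma)}(e_H)$ such that $f^{-1}(V)$ is $f^{-1}(f(U))$-thin; (b) for every $g\in G$ there exists $V_g\in\mathcal V_{(H,\sigma)}(e_H)$ such that $[g,f^{-1}(V_g)]\subseteq f^{-1}(f(U))$. A surjective homomorphism $f:(G,\tau)\to(H,\sigma)$ is A$^*$-open if there exists a section $s$ of $f$ such that for every $U\in\mathcal V_{(G,\tau)}(e_G)$: (a) there exists $V\in\mathcal V_{(H,\sigma)}(e_H)$ such that $s(V)$ is $U$-thin; (b) for every $g\in G$ there exists $V_g\in\mathcal V_{(H,\sigma)}(e_H)$ such that $[g,s(V_g)]\subseteq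 U$. *)

(* Defs.v *)
From HB Require Import structures.
From mathcomp Require Import all_boot.
From mathcomp Require Import boolp classical_sets functions topology.

Set Implicit Arguments.
Unset Strict Implicit.
Unset Printing Implicit Defensive.

Local Open Scope classical_set_scope.
Local Open Scope group_scope.

HB.mixin Record isTopologicalGroup G of Group G & Topological G := {
  mulg_continuous : continuous (fun x : G * G => x.1 * x.2);
  invg_continuous : continuous (fun x : G => x^-1)
}.

#[short(type="topologicalGroupType")]
HB.structure Definition TopologicalGroup :=
  {G of Group G & Topological G & isTopologicalGroup G}.

(* When M is empty the intersection is all of G, so M is U-thin. *)
Definition thin (G : topologicalGroupType) (U M : set G) : Prop :=
  nbhs (1 : G) (\bigcap_(x in M) [set x^-1 * u * x | u in U]).

(* MathComp's [~ x, y] is x^-1 * y^-1 * x * y, a different convention. *)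
Definition lcommg (G : groupType) (x y : G) : G := x * y * x^-1 * y^-1.

Definition lcommg_set (G : groupType) (g : G) (K : set G) : set G :=
  [set lcommg g k | k in K].

Definition A_open (G H : topologicalGroupType) (f : {multiplicative G -> H}) :
    Prop :=
  forall U : set G, nbhs (1 : G) U ->
    (exists2 V : set H, nbhs (1 : H) V &
      thin (f @^-1` (f @` U)) (f @^-1` V)) /\
    (forall g : G, exists2 V : set H, nbhs (1 : H) V &
      lcommg_set g (f @^-1` V) `<=` f @^-1` (f @` U)).

Definition is_section (G H : groupType) (f : {multiplicative G -> H})
    (s : H -> G) : Prop :=
  [/\ injective s, cancel s f & s 1 = 1].

Definition Astar_open (G H : topologicalGroupType)
    (f : {multiplicative G -> H}) : Prop :=
  exists2 s : H -> G, is_section f s &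
    forall U : set G, nbhs (1 : G) U ->
      (exists2 V : set H, nbhs (1 : H) V & thin U (s @` V)) /\
      (forall g : G, exists2 V : set H, nbhs (1 : H) V &
        lcommg_set g (s @` V) `<=` U).

(* Main.v *)
Require Import Defs.
From mathcomp Require Import all_boot.
From mathcomp Require Import boolp classical_sets functions topology.

(** The set [f @^-1` (f @` U)] is saturated: whether an element belongs to it
    depends only on its image under [f].  Conjugates [y w y^-1] and commutators
    [g y g^-1 y^-1] have images determined by [f y], and [s (f y)] has the same
    image as [y]; so [y] may be traded for its representative [s (f y)], which
    lies in [s @` V] as soon as [y] lies in [f @^-1` V].  Hence a neighborhood
    [V] witnessing either A*-openness condition for [U] witnesses the
    corresponding A-openness condition, for the same [U]. *)

Local Open Scope classical_set_scope.
Local Open Scope group_scope.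

(** A multiplicative map is only known to respect products, so the identity is
    kept out of the proof: [f x * f (x^-1) * f x = f x] follows from
    multiplicativity alone, and cancelling [f x] on both sides suffices. *)
Lemma multiplicativeV (G H : groupType) (f : {multiplicative G -> H}) :
  {morph f : x / x^-1}.
Proof.
move=> x; apply: (mulgI (f x)); apply: (mulIg (f x)).
by rewrite -!gmulfM mulgVK mulgVK.
Qed.

(** The intersection defining thinness of [s @` V] is already contained in the
    one defining thinness of [f @^-1` V]. *)
Lemma thin_preimage (G H : topologicalGroupType) (f : {multiplicative G -> H})
    (s : H -> G) (U : set G) (V : set H) :
  cancel s f -> thin U (s @` V) -> thin (f @^-1` (f @` U)) (f @^-1` V).
Proof.
rewrite /thin => sK; apply: filterS => w Ww y Vy.
have [u Uu uw] : [set (s (f y))^-1 * u * s (f y) | u in U] w.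
  by apply: Ww; exists (f y).
exists (y * w * y^-1); last by rewrite !mulgA mulVg mul1g mulgVK.
by exists u => //; rewrite -uw !gmulfM !multiplicativeV sK !mulgA mulgV mul1g mulgK.
Qed.

Lemma lcommg_set_preimage (G H : groupType) (f : {multiplicative G -> H})
    (s : H -> G) (U : set G) (V : set H) (g : G) :
  cancel s f -> lcommg_set g (s @` V) `<=` U ->
  lcommg_set g (f @^-1` V) `<=` f @^-1` (f @` U).
Proof.
move=> sK sVU _ [y Vy <-]; exists (lcommg g (s (f y))).
  by apply: sVU; exists (s (f y)) => //; exists (f y).
by rewrite /lcommg !gmulfM !multiplicativeV sK.
Qed.

Local Close Scope group_scope.

Theorem proposition4p17 (G H : topologicalGroupType)
    (f : {multiplicative G -> H}) (f_continuous : continuous f)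
    (f_surjective : set_surj [set: G] [set: H] f) :
  Astar_open f -> A_open f.
Proof.
move=> [s [_ sK _] sP] U U1; have [[V V1 thinV] commV] := sP U U1; split.
  by exists V => //; apply: thin_preimage thinV.
move=> g; have [W W1 WU] := commV g.
by exists W => //; apply: lcommg_set_preimage WU.
Qed.
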